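(* For every $p\ge1$ and $n\ge1$ the universal connection $\nabla_p=d-\varpi_p$, $\varpi_p=\sum_{i=1}^n\hat H_i(\mathbf t)\,dt_i$, on the trivial vector bundle $\mathrm{Conf}_n(\mathbb C)\times U(\mathfrak g_p)^{\otimes(n+1)}\to\mathrm{Conf}_n(\mathbb C)$ is flat, i.e. $d\varpi_p=\varpi_p\wedge\varpi_p$; in particular the Hamiltonians commute: $[\hat H_i(\mathbf t),\hat H_j(\mathbf t)]=0$ for all $i,j$.
   Context: $\mathfrak g$ finite-dimensional simple complex Lie algebra, minimal invariant form $(\cdot\mid\cdot)$, dual bases $(X_k),(X^k)$, dual Coxeter number $h^\vee$, level $\kappa\neq-h^\vee$. $\mathfrak g_p=\mathfrak g[[z]]/z^p\mathfrak g[[z]]$, $\Omega_{ml}=\sum_k(X_k\otimes z^m)\otimes(X^k\otimes z^l)\in\mathfrak g_p^{\otimes2}$ (zero when $m\ge p$ or $l\ge p$). The tensor factors of $U(\mathfrak g_p)^{\otimes(n+1)}$ are indexed by $J=\{1,\dots,n,\infty\}$, and $a^{(ij)}$ denotes $a\in\mathfrak g_p^{\otimes2}$ placed in factors $i,j$. For $\mathbf t=(t_1,\dots,t_n)\in\mathrm{Conf}_n(\mathbb C)$ and $i\in\{1,\dots,n\}$, $\hat H_i=\hat H_i'+\hat H_i''$ with $$\hat H_i'(\mathbf t)=-\frac{1}{\kappa+h^\vee}\sum_{j\in\{1,\dots,n\}\setminus\{i\}}\sum_{m,l=0}^{p-1}\binom{m+l}{l}(-1)^m(t_i-t_j)^{-1-m-l}\,\Omega^{(ij)}_{ml},$$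 $$\hat H_i''(\mathbf t)=\frac{1}{\kappa+h^\vee}\sum_{m,l=0}^{p-1}\binom{m+l}{l}t_i^{\,l}\,\Omega^{(i\infty)}_{m,m+l+1}.$$ *)

(* Defs.v *)
From HB Require Import structures.
From mathcomp Require Import all_boot all_order all_algebra.
From mathcomp Require Import complex.
From mathcomp Require Import all_classical all_reals all_analysis.
Set Implicit Arguments. Unset Strict Implicit. Unset Printing Implicit Defensive.
Import Order.TTheory GRing.Theory Num.Theory.
Import numFieldNormedType.Exports.
Local Open Scope ring_scope.

(* The complex numbers C = R[i] over a real field R : realType,
   viewed as a numFieldType (norm = modulus), hence as a normed space
   over itself, so that complex derivatives make sense. *)
Definition CC (R : realType) : numFieldType := (R[i])%C.

Section LieAlgebra.
Variables (K : fieldType) (g : vectType K) (br : g -> g -> g).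

Definition is_lie_bracket : Prop :=
  [/\ (forall a x y z, br (a *: x + y) z = a *: br x z + br y z),
      (forall a x y z, br z (a *: x + y) = a *: br z x + br z y),
      (forall x, br x x = 0)
    & (forall x y z, br x (br y z) + br y (br z x) + br z (br x y) = 0)].

Definition lie_ideal (I : {vspace g}) : Prop :=
  forall x y, y \in I -> br x y \in I.

Definition simple_lie : Prop :=
  [/\ is_lie_bracket,
      (exists x y, br x y != 0)
    & forall I, lie_ideal I -> I = 0%VS \/ I = fullv].

Definition killing (x y : g) : K :=
  \sum_(k < \dim (fullv : {vspace g}))
     coord (vbasis fullv) k (br x (br y (tnth (vbasis fullv) k))).

Definition invariant_form (B : g -> g -> K) : Prop :=
  [/\ (forall a x y z, B (a *: x + y) z = a * B x z + B y z),
      (forall x y, B x y = B y x)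
    & (forall x y z, B (br x y) z = B x (br y z))].
End LieAlgebra.

(* Representations of g_p^{(+) J}, J = option 'I_n (None = infinity),  *)
(* in an associative C-algebra A.  rho j m x is the image of the        *)
(* element (x (x) z^m) of g_p = g[[z]]/z^p g[[z]] placed in factor j.  *)
Section Rep.
Variables (K : fieldType) (g : vectType K) (br : g -> g -> g).
Variables (p n : nat) (A : algType K) (rho : option 'I_n -> 'I_p -> g -> A).

Definition zel (j : option 'I_n) (m : nat) (x : g) : A :=
  match (insub m : option 'I_p) with Some m' => rho j m' x | None => 0 end.

(* rho is a Lie algebra morphism from the direct sum of n+1 copies of g_p
   into A (with the commutator bracket); elements of distinct factors commute. *)
Definition is_current_rep : Prop :=
  (forall j m a x y, rho j m (a *: x + y) = a *: rho j m x + rho j m y) /\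
  (forall j k (m l : 'I_p) x y,
      rho j m x * rho k l y - rho k l y * rho j m x
      = if j == k then zel j (m + l) (br x y) else 0).

Definition Omega (d : nat) (X Xd : 'I_d -> g) (i j : option 'I_n) (m l : nat) : A :=
  \sum_(k < d) zel i m (X k) * zel j l (Xd k).
End Rep.

Section Ham.
Variables (R : realType) (g : vectType (CC R)) (br : g -> g -> g).
Variables (p n : nat) (A : algType (CC R)) (rho : option 'I_n -> 'I_p -> g -> A).
Variables (d : nat) (X Xd : 'I_d -> g) (kappa hv : CC R).

Local Notation Om := (Omega rho X Xd).

Definition Hhat1 (i : 'I_n) (t : 'I_n -> CC R) : A :=
  - ((kappa + hv)^-1 *:
     \sum_(j < n | j != i) \sum_(m < p) \sum_(l < p)
        ('C(m + l, l)%:R * (-1) ^+ m * (t i - t j) ^- (1 + m + l))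
          *: Om (Some i) (Some j) m l).

Definition Hhat2 (i : 'I_n) (t : 'I_n -> CC R) : A :=
  (kappa + hv)^-1 *:
     \sum_(m < p) \sum_(l < p)
        ('C(m + l, l)%:R * t i ^+ l) *: Om (Some i) None m (m + l + 1).

Definition Hhat (i : 'I_n) (t : 'I_n -> CC R) : A := Hhat1 i t + Hhat2 i t.
End Ham.

Definition conf (R : realType) (n : nat) (t : 'I_n -> CC R) : Prop :=
  forall i j, i != j -> t i != t j.

Definition upd (R : realType) (n : nat) (t : 'I_n -> CC R) (j : 'I_n) (h : CC R) :
  'I_n -> CC R := fun k => t k + (if k == j then h else 0).

(* On the (open) set U, F is C-differentiable in t_j with partial derivative D:
   F is locally a finite combination sum_k f_k(t) a_k of fixed vectors a_k in A
   with scalar coefficients f_k complex-differentiable in t_j, and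
   D = sum_k (d f_k / d t_j) a_k. *)
Definition has_partial_on (R : realType) (n : nat) (A : lmodType (CC R))
    (U : ('I_n -> CC R) -> Prop) (F : ('I_n -> CC R) -> A) (j : 'I_n)
    (D : ('I_n -> CC R) -> A) : Prop :=
  exists (N : nat) (f df : 'I_N -> ('I_n -> CC R) -> CC R) (a : 'I_N -> A),
    forall t, U t ->
      [/\ F t = \sum_(k < N) f k t *: a k,
          D t = \sum_(k < N) df k t *: a k
        & forall k, is_derive (0 : CC R) (1 : CC R) (fun h => f k (upd t j h)) (df k t)].

Arguments conf {R n} t.
Arguments has_partial_on {R n A} U F j D.

(* Main.v *)
Require Import Defs.
From HB Require Import structures.
From mathcomp Require Import all_boot all_order all_algebra.
From mathcomp Require Import complex.
From mathcomp Require Import all_classical all_reals all_analysis.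
From mathcomp Require Import ring.
Set Implicit Arguments. Unset Strict Implicit. Unset Printing Implicit Defensive.
Import Order.TTheory GRing.Theory Num.Theory.
Import numFieldNormedType.Exports.
Local Open Scope ring_scope.

(** Put [u_i = t_i + z_i], where [z_i] is multiplication by [z] in the [i]-th factor, and
    [1 / u_oo = z_oo].  Expanding geometric series in the nilpotent [z]'s shows
    [H_i = - (kappa + hv)^-1 * \sum_(b != i) Omega_ib / (u_i - u_b)], so the Hamiltonians
    are Gaudin Hamiltonians of the rational r-matrix.  They commute by the classical
    Yang-Baxter equation, which reduces, through the invariance and symmetry of [Omega],
    to the partial fraction identity
    [1/(u_a-u_b)(u_a-u_c) - 1/(u_a-u_b)(u_b-u_c) + 1/(u_a-u_c)(u_b-u_c) = 0].
    For [i != j], only the pair term [Omega_ij / (u_j - u_i)] of [H_j] depends on [t_i],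
    and its derivative [Omega_ij / (u_i - u_j)^2] is symmetric in [i] and [j]. *)

(** * Partial fractions in nilpotent variables *)

(** The sums truncate the expansions of [1 / (t - y) ^ m.+2] and [1 / (t - y) ^ m.+1].
    Multiplication by [t - y] telescopes by Pascal's rule and leaves one boundary term, a multiple
    of [y ^+ p]. *)
Lemma geometric_step (P : comNzRingType) (p m : nat) (t s y : P) :
  t * s = 1 ->
  (t - y) * (\sum_(l < p) 'C(m.+1 + l, l)%:R * s ^+ (m.+2 + l) * y ^+ l)
    = \sum_(l < p) 'C(m + l, l)%:R * s ^+ (m.+1 + l) * y ^+ l
      - 'C(m + p, m.+1)%:R * s ^+ (m.+1 + p) * y ^+ p.
Proof.
move=> ts; elim: p => [|p IH].
  by rewrite !big_ord0 addn0 bin_small // mulr0 !mul0r subr0.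
rewrite !big_ord_recr /= mulrDr IH.
have -> : 'C(m.+1 + p, p) = ('C(m + p, m) + 'C(m + p, m.+1))%N.
  by rewrite -bin_sub ?leq_addl // addnK addSn binS addnC.
have -> : 'C(m + p.+1, m.+1) = ('C(m + p, m) + 'C(m + p, m.+1))%N.
  by rewrite addnS binS addnC.
have -> : 'C(m + p, p) = 'C(m + p, m) by rewrite -bin_sub ?leq_addl // addnK.
rewrite !addSn !addnS !natrD !exprS.
set c := _%:R; set e := _%:R; set S := \sum_(i < p) _.
(* A multiple of [t * s - 1 = 0] is added on the right, after which both sides agree as
   polynomials. *)
rewrite -[RHS]addr0 -[0 in RHS](mulr0 (s * s ^+ (m + p) * y ^+ p * (c + e))).
rewrite -[0 in RHS](subrr (t * s)) {2}ts; ring.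
Qed.

Lemma geometric_base (P : comNzRingType) (p : nat) (t s y : P) :
  t * s = 1 ->
  (t - y) * (\sum_(l < p) s ^+ (1 + l) * y ^+ l) = 1 - s ^+ p * y ^+ p.
Proof.
move=> ts; elim: p => [|p IH].
  by rewrite big_ord0 mulr0 !expr0 mulr1 subrr.
rewrite big_ord_recr /= mulrDr IH add1n !exprS.
rewrite -[RHS]addr0 -[0 in RHS](mulr0 (s ^+ p * y ^+ p)).
rewrite -[0 in RHS](subrr (t * s)) {2}ts; ring.
Qed.

(* The double sum is the expansion of [1 / (t + x - y)] truncated in both variables. *)
Lemma shifted_inverse (P : comNzRingType) (p : nat) (t s x y : P) :
  t * s = 1 ->
  exists a b, (t + x - y) *
    (\sum_(m < p) \sum_(l < p)
       'C(m + l, l)%:R * (-1) ^+ m * s ^+ (1 + m + l) * (x ^+ m * y ^+ l))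
    = 1 + a * x ^+ p + b * y ^+ p.
Proof.
move=> ts.
pose S m := \sum_(l < p) 'C(m + l, l)%:R * s ^+ (m.+1 + l) * y ^+ l.
have -> : \sum_(m < p) \sum_(l < p)
   'C(m + l, l)%:R * (-1) ^+ m * s ^+ (1 + m + l) * (x ^+ m * y ^+ l)
   = \sum_(m < p) (- x) ^+ m * S m.
  apply: eq_bigr => m _; rewrite mulr_sumr; apply: eq_bigr => l _.
  rewrite (exprNn x) add1n; ring.
have S0 : (t - y) * S 0%N = 1 - s ^+ p * y ^+ p.
  rewrite -(geometric_base _ _ ts); congr (_ * _); apply: eq_bigr => l _.
  by rewrite add0n binn mul1r.
(* Modulo [y ^+ p], [(t - y) * S m.+1] is [S m], and it cancels against [x] times the preceding
   term: the sum over [m] telescopes. *)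
have aux q : exists b, (t + x - y) * (\sum_(m < q.+1) (- x) ^+ m * S m)
    = 1 - (- x) ^+ q.+1 * S q + b * y ^+ p.
  elim: q => [|q [b IH]].
    exists (- s ^+ p); rewrite big_ord_recr big_ord0 /= add0r expr0 mul1r expr1.
    rewrite addrAC mulrDl S0; ring.
  have [c Ec] : exists c, (t - y) * S q.+1 = S q - c * y ^+ p.
    by exists ('C(q + p, q.+1)%:R * s ^+ (q.+1 + p)); rewrite (geometric_step _ _ _ ts).
  exists (b - (- x) ^+ q.+1 * c); rewrite big_ord_recr /= mulrDr IH.
  rewrite (_ : _ * ((- x) ^+ q.+1 * _)
    = (- x) ^+ q.+1 * ((t - y) * S q.+1) - (- x) ^+ q.+2 * S q.+1); last first.
    rewrite !exprS; ring.
  rewrite Ec !exprS; ring.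
(* For [p = 0] the sum is empty and [x ^+ 0 = 1], so the error term must cancel the [1]. *)
case: p S S0 aux => [|p] S S0 aux.
  by exists (-1), 0; rewrite big_ord0 mulr0 !expr0; ring.
have [b ->] := aux p; exists (- ((-1) ^+ p.+1 * S p)), b.
rewrite (exprNn x); ring.
Qed.

(* With [w = 1 / u_oo], this inverts [(u_oo - u) / u_oo] for [u = c + x]. *)
Lemma shifted_inverse_infty (P : comNzRingType) (p : nat) (c x w : P) :
  exists b, (1 - w * (c + x)) *
    (\sum_(m < p) \sum_(l < p)
       'C(m + l, l)%:R * c ^+ l * x ^+ m * w ^+ (m + l)) = 1 + b * w ^+ p.
Proof.
(* Here [1 - w * (c + x)] is read as [1 + x' - y'] with [x' = - (x * w)] and [y' = c * w]; both
   [p]-th powers are multiples of [w ^+ p]. *)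
have [a [b E]] := shifted_inverse p (- (x * w)) (c * w) (mulr1 1).
exists (a * (- x) ^+ p + b * c ^+ p).
transitivity ((1 - x * w - c * w) *
    (\sum_(m < p) \sum_(l < p) 'C(m + l, l)%:R * (-1) ^+ m * 1 ^+ (1 + m + l) *
       ((- (x * w)) ^+ m * (c * w) ^+ l))); last first.
  by rewrite E -mulNr !exprMn; ring.
rewrite (_ : 1 - w * _ = 1 - x * w - c * w); last by ring.
congr (_ * _); apply: eq_bigr => m _; apply: eq_bigr => l _.
rewrite (expr1n _ (1 + m + l)) mulr1 (exprNn (x * w)) !exprMn exprD.
have sq : (-1) ^+ m * (-1) ^+ m = 1 :> P by rewrite -expr2 sqrr_sign.
by rewrite -[LHS]mulr1 -[X in _ * X = _]sq; ring.
Qed.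

(** * Linear forms on truncated polynomials in three variables *)

Section Trilinear.
Variables (K : fieldType) (A : lmodType K) (p : nat) (T : nat -> nat -> nat -> A).
Hypothesis T0 : forall m l s, (p <= m)%N || (p <= l)%N || (p <= s)%N -> T m l s = 0.

Local Notation P := {poly {poly {poly K}}}.

(* A linear form on [K[x,y,z] / (x^p, y^p, z^p)]; the outermost indeterminate is [x]. *)
Definition trunc_eval (q : P) : A :=
  \sum_(m < p) \sum_(l < p) \sum_(s < p) q`_m`_l`_s *: T m l s.

Definition cst3 (c : K) : P := c%:P%:P%:P.
Definition va : P := 'X.
Definition vb : P := 'X%:P.
Definition vc : P := 'X%:P%:P.

Lemma cst3M (x y : K) : cst3 (x * y) = cst3 x * cst3 y.
Proof. by rewrite /cst3 !rmorphM. Qed.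

Lemma cst3X (c : K) k : cst3 (c ^+ k) = cst3 c ^+ k.
Proof. by rewrite /cst3 !rmorphXn. Qed.

Lemma cst3_nat k : cst3 (k%:R : K) = k%:R.
Proof. by rewrite /cst3 !rmorph_nat. Qed.

Lemma cst3N (c : K) : cst3 (- c) = - cst3 c.
Proof. by rewrite /cst3 !rmorphN. Qed.

Lemma cst3B (c d : K) : cst3 (c - d) = cst3 c - cst3 d.
Proof. by rewrite /cst3 !rmorphB. Qed.

Lemma cst31 : cst3 (1 : K) = 1.
Proof. by rewrite /cst3 !rmorph1. Qed.

Lemma trunc_evalD q r : trunc_eval (q + r) = trunc_eval q + trunc_eval r.
Proof.
rewrite /trunc_eval -!big_split; apply: eq_bigr => m _.
rewrite -!big_split; apply: eq_bigr => l _.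
rewrite -!big_split; apply: eq_bigr => s _ /=.
by rewrite !coefD scalerDl.
Qed.

Lemma trunc_evalZ c q : trunc_eval (cst3 c * q) = c *: trunc_eval q.
Proof.
rewrite /trunc_eval scaler_sumr; apply: eq_bigr => m _.
rewrite scaler_sumr; apply: eq_bigr => l _.
rewrite scaler_sumr; apply: eq_bigr => s _.
by rewrite !coefCM scalerA.
Qed.

Lemma trunc_eval0 : trunc_eval 0 = 0.
Proof.
by rewrite /trunc_eval; do 3![apply: big1 => ? _]; rewrite !coef0 scale0r.
Qed.

Lemma trunc_evalN q : trunc_eval (- q) = - trunc_eval q.
Proof. by apply/eqP; rewrite -addr_eq0 -trunc_evalD addNr trunc_eval0. Qed.

Lemma trunc_eval_sum (I : finType) (F : I -> P) :
  trunc_eval (\sum_i F i) = \sum_i trunc_eval (F i).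
Proof. exact: (big_morph _ trunc_evalD trunc_eval0). Qed.

Lemma trunc_eval_va q : trunc_eval (q * va ^+ p) = 0.
Proof.
rewrite /trunc_eval /va; do 3![apply: big1 => ? _].
by rewrite coefMXn ltn_ord !coef0 scale0r.
Qed.

Lemma trunc_eval_vb q : trunc_eval (q * vb ^+ p) = 0.
Proof.
rewrite /trunc_eval /vb; do 3![apply: big1 => ? _].
by rewrite -rmorphXn coefMC coefMXn ltn_ord !coef0 scale0r.
Qed.

Lemma trunc_eval_vc q : trunc_eval (q * vc ^+ p) = 0.
Proof.
rewrite /trunc_eval /vc; do 3![apply: big1 => ? _].
by rewrite -!rmorphXn !coefMC coefMXn ltn_ord scale0r.
Qed.

(** No bound on the exponents is required: a monomial with an exponent at least [p] is a multiple of
    a killed [p]-th power, and [T] vanishes there by [T0]. *)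
Lemma trunc_eval_mono c m l s :
  trunc_eval (cst3 c * (va ^+ m * vb ^+ l * vc ^+ s)) = c *: T m l s.
Proof.
rewrite trunc_evalZ; congr (_ *: _).
have [|/norP[/norP[]]] := boolP ((p <= m) || (p <= l) || (p <= s))%N.
  move=> h; rewrite (T0 h); case/orP: h => [/orP[]|] h.
  - rewrite -(subnK h) exprD [X in trunc_eval X](_ : _ =
      (va ^+ (m - p) * vb ^+ l * vc ^+ s) * va ^+ p) ?trunc_eval_va //; ring.
  - rewrite -(subnK h) exprD [X in trunc_eval X](_ : _ =
      (va ^+ m * vb ^+ (l - p) * vc ^+ s) * vb ^+ p) ?trunc_eval_vb //; ring.
  - rewrite -(subnK h) exprD [X in trunc_eval X](_ : _ =
      (va ^+ m * vb ^+ l * vc ^+ (s - p)) * vc ^+ p) ?trunc_eval_vc //; ring.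
rewrite -!ltnNge => hm hl hs; rewrite /trunc_eval.
have E m' l' s' : (va ^+ m * vb ^+ l * vc ^+ s)`_m'`_l'`_s'
   = ((m' == m) && (l' == l) && (s' == s))%:R :> K.
  rewrite /va /vb /vc -!rmorphXn -mulrA -rmorphM coefMC coefXn.
  case: (m' == m); last by rewrite mul0r !coef0.
  rewrite mul1r coefMC coefXn.
  case: (l' == l); last by rewrite mul0r !coef0.
  by rewrite mul1r coefXn.
rewrite (bigD1 (Ordinal hm)) //= (bigD1 (Ordinal hl)) //= (bigD1 (Ordinal hs)) //=.
rewrite E !eqxx scale1r big1 ?addr0; last first.
  by move=> i /negbTE; rewrite -val_eqE /= => hi; rewrite E hi andbF scale0r.
rewrite big1 ?addr0; last first.
  move=> i /negbTE; rewrite -val_eqE /= => hi; apply: big1 => j _.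
  by rewrite E hi andbF scale0r.
rewrite big1 ?addr0 //.
move=> i /negbTE; rewrite -val_eqE /= => hi; do 2![apply: big1 => ? _].
by rewrite E hi scale0r.
Qed.

(* The hypothesis on [Fac - Fbc] holds both for [1 / (u_a - u_c)] and for the pole at infinity. *)
Lemma trunc_eval_cybe (e Fab Fac Fbc : P) (a1 b1 a2 b2 c2 : P) :
  e * Fab = 1 + a1 * va ^+ p + b1 * vb ^+ p ->
  Fac - Fbc = - (e * Fac * Fbc) + a2 * va ^+ p + b2 * vb ^+ p + c2 * vc ^+ p ->
  trunc_eval (Fab * Fac) - trunc_eval (Fab * Fbc) + trunc_eval (Fac * Fbc) = 0.
Proof.
move=> h1 h2.
rewrite -trunc_evalN -!trunc_evalD.
have -> : Fab * Fac + - (Fab * Fbc) + Fac * Fbc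
  = (Fab * a2 - a1 * Fac * Fbc) * va ^+ p + (Fab * b2 - b1 * Fac * Fbc) * vb ^+ p
    + (Fab * c2) * vc ^+ p.
  rewrite -mulrBr h2.
  (* Substituting for [Fac - Fbc] makes [1 - e * Fab] appear, which is a combination of [p]-th
     powers by [h1]. *)
  transitivity (Fac * Fbc * (1 - e * Fab) +
     Fab * (a2 * va ^+ p + b2 * vb ^+ p + c2 * vc ^+ p)); first by ring.
  rewrite h1; ring.
by rewrite !trunc_evalD trunc_eval_va trunc_eval_vb trunc_eval_vc !addr0.
Qed.
End Trilinear.

(** * Casimir tensors and Gaudin Hamiltonians *)

Definition comm_br (A : pzRingType) (a b : A) : A := a * b - b * a.

Lemma comm_brDl (A : pzRingType) (a b c : A) :
  comm_br (a + b) c = comm_br a c + comm_br b c.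
Proof. by rewrite /comm_br mulrDl mulrDr opprD addrACA. Qed.

Lemma comm_brDr (A : pzRingType) (a b c : A) :
  comm_br c (a + b) = comm_br c a + comm_br c b.
Proof. by rewrite /comm_br mulrDl mulrDr opprD addrACA. Qed.

Lemma comm_brNr (A : pzRingType) (a b : A) : comm_br a (- b) = - comm_br a b.
Proof. by rewrite /comm_br mulrN mulNr opprB opprK addrC. Qed.

Lemma comm_brC (A : pzRingType) (a b : A) : comm_br a b = - comm_br b a.
Proof. by rewrite /comm_br opprB. Qed.

Lemma comm_br0l (A : pzRingType) (a : A) : comm_br 0 a = 0.
Proof. by rewrite /comm_br mul0r mulr0 subrr. Qed.

Lemma comm_br0r (A : pzRingType) (a : A) : comm_br a 0 = 0.
Proof. by rewrite /comm_br mul0r mulr0 subrr. Qed.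

Lemma comm_br_suml (A : pzRingType) (I : Type) (r : seq I) (P : pred I) (F : I -> A) c :
  comm_br (\sum_(i <- r | P i) F i) c = \sum_(i <- r | P i) comm_br (F i) c.
Proof.
by rewrite /comm_br mulr_suml mulr_sumr sumrB.
Qed.

Lemma comm_br_sumr (A : pzRingType) (I : Type) (r : seq I) (P : pred I) (F : I -> A) c :
  comm_br c (\sum_(i <- r | P i) F i) = \sum_(i <- r | P i) comm_br c (F i).
Proof.
by rewrite /comm_br mulr_suml mulr_sumr sumrB.
Qed.

Lemma comm_brZ (K : fieldType) (A : algType K) (x y : K) (a b : A) :
  comm_br (x *: a) (y *: b) = (x * y) *: comm_br a b.
Proof.
by rewrite /comm_br -!scalerAl -!scalerAr !scalerA (mulrC y) scalerBr.
Qed.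

(* The three-term hypothesis is the classical Yang-Baxter equation for the sites i, j, k. *)
Lemma gaudin_comm (A : pzRingType) (J : finType) (r : J -> J -> A) (i j : J) :
  i != j -> r j i = - r i j ->
  (forall k l, k != i -> k != j -> l != i -> l != j -> k != l ->
     comm_br (r i k) (r j l) = 0) ->
  (forall k, k != i -> k != j ->
     comm_br (r i j) (r i k) + comm_br (r i j) (r j k) + comm_br (r i k) (r j k) = 0) ->
  comm_br (\sum_(k | k != i) r i k) (\sum_(k | k != j) r j k) = 0.
Proof.
move=> ij rji rkl cybe.
rewrite (bigD1 j) /=; last by rewrite eq_sym.
rewrite [X in comm_br _ X](bigD1 i) //= rji.
rewrite [X in comm_br _ (_ + X)](eq_bigl (fun k => (k != i) && (k != j))); last first.
  by move=> k; rewrite andbC.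
rewrite comm_brDl !comm_brDr !comm_brNr [comm_br (r i j) (r i j)]/comm_br subrr oppr0 add0r.
rewrite -comm_brC comm_br_suml !comm_br_sumr addrA -!big_split /=.
(* For fixed [k], only [l = k] survives in the sum of the [comm_br (r i k) (r j l)], which leaves
   the three Yang-Baxter terms for [i, j, k]. *)
apply: big1 => k /andP[ki kj]; rewrite comm_br_sumr (bigD1 k) /=; last by rewrite ki.
rewrite big1 ?addr0; last first.
  by move=> l /andP[/andP[li lj] lk]; apply: rkl => //; rewrite eq_sym.
by rewrite (addrC (comm_br _ (r j k))) cybe.
Qed.

(** * Linear maps, dual bases and the Casimir element *)

Definition lin_map (K : fieldType) (g V : lmodType K) (f : g -> V) :=
  forall a x y, f (a *: x + y) = a *: f x + f y.

Section LinMap.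
Variables (K : fieldType) (g V : lmodType K) (f : g -> V).
Hypothesis lf : lin_map f.

Lemma lin_map0 : f 0 = 0.
Proof.
have := lf (-1) 0 0; rewrite scaler0 addr0 scaleN1r.
by rewrite addNr.
Qed.

Lemma lin_mapN x : f (- x) = - f x.
Proof. by have := lf (-1) x 0; rewrite lin_map0 !addr0 !scaleN1r. Qed.

Lemma lin_map_sum (I : finType) (c : I -> K) (v : I -> g) :
  f (\sum_i c i *: v i) = \sum_i c i *: f (v i).
Proof.
elim/big_rec2: _ => [|i y1 y2 _ <-]; first exact: lin_map0.
exact: lf.
Qed.
End LinMap.

Section LieBracket.
Variables (K : fieldType) (g : vectType K) (br : g -> g -> g).
Hypothesis brP : is_lie_bracket br.

Lemma lie_antisym u v : br u v = - br v u.
Proof.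
case: brP => h1 h2 br0 _.
have := br0 (1 *: u + v); rewrite h1 !h2 !br0 !scale1r addr0 add0r.
by move/eqP; rewrite addr_eq0 => /eqP.
Qed.
End LieBracket.

Section DualBases.
Variables (K : fieldType) (g : vectType K) (br : g -> g -> g) (B : g -> g -> K).
Variables (X Xd : 'I_(\dim (fullv : {vspace g})) -> g).
Hypothesis BP : invariant_form br B.
Hypothesis BXXd : forall k l, B (X k) (Xd l) = (k == l)%:R.

Lemma form_linl z : lin_map (B^~ z : g -> K^o).
Proof. by case: BP => h _ _ a x y; rewrite h. Qed.

(** Pairing with [Xd i] extracts the [i]-th coefficient, so [X] is free; having [\dim fullv] members
    it is a basis, and the same pairing computes the coordinates. *)
Lemma dual_basis_expl x : x = \sum_k B x (Xd k) *: X k.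
Proof.
have fX : free (mktuple X).
  apply/freeP => c c0 i.
  have := form_linl (Xd i).
  move/(@lin_map_sum _ _ _ _)/(_ _ c X).
  have -> : \sum_k c k *: X k = 0.
    rewrite -[RHS]c0; apply: eq_bigr => k _; congr (_ *: _).
    by rewrite nth_mktuple.
  rewrite (lin_map0 (form_linl _)) (bigD1 i) //= BXXd eqxx big1 ?addr0.
    by move=> /esym; rewrite /GRing.scale /= mulr1.
  by move=> k /negbTE ki; rewrite BXXd ki scaler0.
have bX : basis_of fullv (mktuple X).
  by rewrite basisEfree fX subvf size_tuple /=.
have ex : exists c : 'I_(\dim (fullv : {vspace g})) -> K, x = \sum_k c k *: X k.
  eexists; rewrite {1}(coord_basis bX (memvf x)).
  apply: eq_bigr => k _; congr (_ *: _).
  by rewrite nth_mktuple.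
case: ex => c ->; apply: eq_bigr => k _; congr (_ *: _).
rewrite (lin_map_sum (form_linl (Xd k))) (bigD1 k) //= BXXd eqxx big1.
  by rewrite addr0 /GRing.scale /= mulr1.
by move=> l /negbTE lk; rewrite BXXd lk scaler0.
Qed.
End DualBases.

Section Casimir.
Variables (K : fieldType) (g : vectType K) (br : g -> g -> g) (B : g -> g -> K).
Variables (X Xd : 'I_(\dim (fullv : {vspace g})) -> g).
Hypothesis brP : is_lie_bracket br.
Hypothesis BP : invariant_form br B.
Hypothesis BXXd : forall k l, B (X k) (Xd l) = (k == l)%:R.

Lemma dual_basis_expr y : y = \sum_k B (X k) y *: Xd k.
Proof.
case: (BP) => _ sym _.
rewrite {1}(@dual_basis_expl _ _ _ _ Xd X BP _ y); last first.
  by move=> k l; rewrite sym BXXd eq_sym.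
by apply: eq_bigr => k _; rewrite sym.
Qed.

Variables (V : lmodType K) (f : g -> g -> V).
Hypothesis fl : forall y, lin_map (f^~ y).
Hypothesis fr : forall x, lin_map (f x).

(** Expanding [Xd] in the basis [X] turns both sides into sums with the symmetric Gram matrix
    [B (Xd k) (Xd l)]. *)
Lemma casimir_sym : \sum_k f (X k) (Xd k) = \sum_k f (Xd k) (X k).
Proof.
case: (BP) => _ sym _.
transitivity (\sum_k \sum_l B (Xd k) (Xd l) *: f (X k) (X l)).
  apply: eq_bigr => k _; rewrite {1}(dual_basis_expl BP BXXd (Xd k)).
  exact: lin_map_sum.
rewrite exchange_big; apply: eq_bigr => l _ /=.
rewrite {2}(dual_basis_expl BP BXXd (Xd l)) (lin_map_sum (fl _)).
by apply: eq_bigr => k _; rewrite sym.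
Qed.

(** By invariance of [B], the matrices of [br x] in the bases [X] and [Xd] are negative transposes
    of each other. *)
Lemma casimir_inv x :
  \sum_k f (br x (X k)) (Xd k) = - \sum_k f (X k) (br x (Xd k)).
Proof.
case: (BP) => _ sym inv.
transitivity (\sum_k \sum_l B (br x (X k)) (Xd l) *: f (X l) (Xd k)).
  apply: eq_bigr => k _; rewrite {1}(dual_basis_expl BP BXXd (br x (X k))).
  exact: (lin_map_sum (fl _)).
rewrite exchange_big -sumrN; apply: eq_bigr => l _ /=.
rewrite {1}(dual_basis_expr (br x (Xd l))) (lin_map_sum (fr _)) -sumrN.
apply: eq_bigr => k _; rewrite -scaleNr; congr (_ *: _).
by rewrite -inv (lie_antisym brP x) (lin_mapN (form_linl BP _)).
Qed.
End Casimir.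

(** * Commutators of Casimir tensors placed at the sites *)

Section Sites.
Variables (K : fieldType) (g : vectType K) (br : g -> g -> g) (B : g -> g -> K).
Variables (X Xd : 'I_(\dim (fullv : {vspace g})) -> g).
Variables (p n : nat) (A : algType K) (rho : option 'I_n -> 'I_p -> g -> A).
Hypothesis brP : is_lie_bracket br.
Hypothesis BP : invariant_form br B.
Hypothesis BXXd : forall k l, B (X k) (Xd l) = (k == l)%:R.
Hypothesis rhoP : is_current_rep br rho.

Local Notation z := (zel rho).
Local Notation Om := (Omega rho X Xd).

Lemma zel_lin a m : lin_map (z a m).
Proof.
move=> c x y; rewrite /zel; case: insub => [m'|]; last by rewrite scaler0 addr0.
by case: rhoP.
Qed.

Lemma zel_ge a m x : (p <= m)%N -> z a m x = 0.
Proof. by move=> pm; rewrite /zel insubF // ltnNge pm. Qed.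

(** Beyond the truncation both sides vanish: if [m] or [l] is at least [p], so is [m + l]. *)
Lemma comm_zel a b m l x y :
  comm_br (z a m x) (z b l y) = if a == b then z a (m + l) (br x y) else 0.
Proof.
case: (ltnP m p) => mp; last first.
  rewrite (zel_ge a x mp) (@zel_ge _ (m + l)) ?(leq_trans mp) ?leq_addr //.
  by rewrite comm_br0l; case: eqP.
case: (ltnP l p) => lp; last first.
  rewrite (zel_ge b y lp) (@zel_ge _ (m + l)) ?(leq_trans lp) ?leq_addl //.
  by rewrite comm_br0r; case: eqP.
case: rhoP => _ h; have := h a b (Ordinal mp) (Ordinal lp) x y.
have -> : z a m x = rho a (Ordinal mp) x by rewrite /zel insubT.
by have -> : z b l y = rho b (Ordinal lp) y by rewrite /zel insubT.
Qed.

Lemma comm_zel_site a m l x y :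
  z a m x * z a l y - z a l y * z a m x = z a (m + l) (br x y).
Proof. by have := comm_zel a a m l x y; rewrite eqxx. Qed.

Lemma zel_comm a b m l x y : a != b -> z a m x * z b l y = z b l y * z a m x.
Proof.
move=> /negbTE ab; have := comm_zel a b m l x y; rewrite ab.
by move/eqP; rewrite subr_eq0 => /eqP.
Qed.

Lemma Omega_sym a b m l : a != b -> Om a b m l = Om b a l m.
Proof.
move=> ab; rewrite /Omega.
rewrite (@casimir_sym _ _ _ _ X Xd BP BXXd _ (fun x y => z a m x * z b l y)).
- by apply: eq_bigr => k _; rewrite zel_comm.
- by move=> y c x x'; rewrite zel_lin mulrDl scalerAl.
- by move=> x c y y'; rewrite zel_lin mulrDr scalerAr.
Qed.

Lemma Omega_disjoint a b c d m l m' l' :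
  a != c -> a != d -> b != c -> b != d -> comm_br (Om a b m l) (Om c d m' l') = 0.
Proof.
move=> ac ad bc bd; rewrite /Omega comm_br_suml big1 // => k _.
rewrite comm_br_sumr big1 // => j _; rewrite /comm_br.
rewrite !mulrA -(mulrA _ (z b l _)) (zel_comm _ _ _ _ bc) !mulrA.
rewrite (zel_comm _ _ _ _ ac) -!mulrA (zel_comm _ _ _ _ bd).
by rewrite !mulrA -(mulrA _ (z a m _)) (zel_comm _ _ _ _ ad) !mulrA subrr.
Qed.

(** The commutator of two Casimir tensors sharing site [a], with degrees attached. The three
    commutators of the Yang-Baxter equation are all, up to sign, of this form. *)
Definition triple a b c m l s : A :=
  \sum_k \sum_j z a m (br (X k) (X j)) * z b l (Xd k) * z c s (Xd j).

Lemma triple_ge a b c m l s :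
  (p <= m)%N || (p <= l)%N || (p <= s)%N -> triple a b c m l s = 0.
Proof.
move=> h; rewrite /triple; do 2![apply: big1 => ? _].
by case/orP: h => [/orP[]|] h; rewrite (zel_ge _ _ h) ?(mul0r, mulr0).
Qed.

Section Distinct.
Variables (a b c : option 'I_n).
Hypotheses (ab : a != b) (ac : a != c) (bc : b != c).

Lemma comm_Omega_aa m m' l s :
  comm_br (Om a b m l) (Om a c m' s) = triple a b c (m + m') l s.
Proof.
rewrite /Omega comm_br_suml; apply: eq_bigr => k _.
rewrite comm_br_sumr; apply: eq_bigr => j _.
rewrite -comm_zel_site /comm_br !mulrBl; congr (_ - _).
  by rewrite -!mulrA; congr (_ * _); rewrite !mulrA (zel_comm _ _ _ _ ab).
rewrite -!mulrA; congr (_ * _).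
by rewrite [LHS]mulrA -(zel_comm _ _ _ _ ac) -mulrA -(zel_comm _ _ _ _ bc).
Qed.

(** The bracket first appears at the shared site [b]; invariance of the first Casimir tensor moves
    it to [a], which produces the sign. *)
Lemma comm_Omega_bb m l l' s :
  comm_br (Om a b m l) (Om b c l' s) = - triple a b c m (l + l') s.
Proof.
rewrite /triple exchange_big -sumrN /Omega comm_br_sumr; apply: eq_bigr => j _ /=.
rewrite comm_br_suml.
transitivity (\sum_k z a m (X k) * z b (l + l') (br (Xd k) (X j)) * z c s (Xd j)).
  apply: eq_bigr => k _; rewrite -comm_zel_site /comm_br mulrBr mulrBl; congr (_ - _).
    by rewrite !mulrA.
  rewrite -!mulrA (mulrA (z c s _)) -(zel_comm _ _ _ _ ac) -mulrA.
  by rewrite -(zel_comm _ _ _ _ bc) [LHS]mulrA -(zel_comm _ _ _ _ ab) -mulrA.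
rewrite -!mulr_suml -mulNr; congr (_ * _).
under eq_bigr do rewrite (lie_antisym brP) (lin_mapN (@zel_lin _ _)) mulrN.
under [in RHS]eq_bigr do rewrite (lie_antisym brP) (lin_mapN (@zel_lin _ _)) mulNr.
rewrite !sumrN opprK.
rewrite (@casimir_inv _ _ br _ X Xd brP BP BXXd _ (fun x y => z a m x * z b (l + l') y)) ?opprK //.
- by move=> y e x x'; rewrite zel_lin mulrDl scalerAl.
- by move=> x e y y'; rewrite zel_lin mulrDr scalerAr.
Qed.

(** Invariance moves the bracket from [c] to [a]; symmetry of the second Casimir tensor then
    exchanges [X j] and [Xd j]. *)
Lemma comm_Omega_cc m l s s' :
  comm_br (Om a c m s) (Om b c l s') = triple a b c m l (s + s').
Proof.
transitivity (\sum_j \sum_k z a m (X k) * z b l (X j) * z c (s + s') (br (Xd k) (Xd j))).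
  rewrite /Omega comm_br_sumr; apply: eq_bigr => j _.
  rewrite comm_br_suml; apply: eq_bigr => k _.
  rewrite -comm_zel_site /comm_br mulrBr; congr (_ - _).
    rewrite -!mulrA; congr (_ * _).
    by rewrite !mulrA (zel_comm _ _ _ _ bc).
  rewrite -!mulrA (mulrA (z c s' _)) -(zel_comm _ _ _ _ ac) -mulrA [LHS]mulrA.
  by rewrite -(zel_comm _ _ _ _ ab) -!mulrA.
transitivity (\sum_j \sum_k z a m (br (Xd j) (X k)) * z b l (X j) * z c (s + s') (Xd k)).
  apply: eq_bigr => j _.
  rewrite (@casimir_inv _ _ br _ X Xd brP BP BXXd _
    (fun x y => z a m x * z b l (X j) * z c (s + s') y)).
  - by rewrite -sumrN; apply: eq_bigr => k _; rewrite (lie_antisym brP) (lin_mapN (@zel_lin _ _)) mulrN.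
  - by move=> y e x x'; rewrite zel_lin !mulrDl !scalerAl.
  - by move=> x e y y'; rewrite zel_lin mulrDr scalerAr.
rewrite /triple exchange_big [RHS]exchange_big; apply: eq_bigr => k _ /=.
symmetry; apply: (@casimir_sym _ _ _ _ X Xd BP BXXd _
  (fun x y => z a m (br x (X k)) * z b l y * z c (s + s') (Xd k))).
- by move=> y e x x'; case: (brP) => h _ _ _; rewrite h zel_lin !mulrDl !scalerAl.
- by move=> x e y y'; rewrite zel_lin mulrDr mulrDl -scalerAr -scalerAl.
Qed.
End Distinct.

(** * Weighted sums of Casimir tensors and their generating polynomials *)

Section Weighted.
Variable U : finType.
Implicit Types (w : U -> K) (e : U -> nat).

Definition wsum w e1 e2 (a b : option 'I_n) : A := \sum_u w u *: Om a b (e1 u) (e2 u).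

Definition wpoly w e1 e2 (x y : {poly {poly {poly K}}}) :=
  \sum_u cst3 (w u) * (x ^+ e1 u * y ^+ e2 u).

Lemma comm_wsum w1 e1 e2 w2 f1 f2 a b c d :
  comm_br (wsum w1 e1 e2 a b) (wsum w2 f1 f2 c d)
  = \sum_u \sum_v (w1 u * w2 v) *: comm_br (Om a b (e1 u) (e2 u)) (Om c d (f1 v) (f2 v)).
Proof.
rewrite /wsum comm_br_suml; apply: eq_bigr => u _; rewrite comm_br_sumr.
by apply: eq_bigr => v _; rewrite comm_brZ.
Qed.

Lemma comm_wsum_disjoint w1 e1 e2 w2 f1 f2 a b c d :
  a != c -> a != d -> b != c -> b != d ->
  comm_br (wsum w1 e1 e2 a b) (wsum w2 f1 f2 c d) = 0.
Proof.
move=> *; rewrite comm_wsum; do 2![apply: big1 => ? _].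
by rewrite Omega_disjoint // scaler0.
Qed.

Lemma wpoly_mul w1 e1 e2 w2 f1 f2 x1 y1 x2 y2 :
  wpoly w1 e1 e2 x1 y1 * wpoly w2 f1 f2 x2 y2
  = \sum_u \sum_v cst3 (w1 u * w2 v) *
      (x1 ^+ e1 u * y1 ^+ e2 u * (x2 ^+ f1 v * y2 ^+ f2 v)).
Proof.
rewrite /wpoly mulr_suml; apply: eq_bigr => u _; rewrite mulr_sumr.
by apply: eq_bigr => v _; rewrite cst3M; ring.
Qed.

Local Notation L a b c := (trunc_eval p (triple a b c)).

(** Degrees add at a shared site just as exponents add in a product, so each commutator is, up to
    sign, [trunc_eval] of a product of generating polynomials; the signs are those of
    [trunc_eval_cybe]. *)
Lemma wsum_cybe w1 e1 e2 w2 f1 f2 w3 g1 g2 a b c (e a1 b1 a2 b2 c2 : {poly {poly {poly K}}}) :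
  a != b -> a != c -> b != c ->
  let Fab := wpoly w1 e1 e2 (va K) (vb K) in
  let Fac := wpoly w2 f1 f2 (va K) (vc K) in
  let Fbc := wpoly w3 g1 g2 (vb K) (vc K) in
  e * Fab = 1 + a1 * va K ^+ p + b1 * vb K ^+ p ->
  Fac - Fbc = - (e * Fac * Fbc) + a2 * va K ^+ p + b2 * vb K ^+ p + c2 * vc K ^+ p ->
  comm_br (wsum w1 e1 e2 a b) (wsum w2 f1 f2 a c)
  + comm_br (wsum w1 e1 e2 a b) (wsum w3 g1 g2 b c)
  + comm_br (wsum w2 f1 f2 a c) (wsum w3 g1 g2 b c) = 0.
Proof.
move=> ab ac bc Fab Fac Fbc h1 h2.
have T0 := @triple_ge a b c.
rewrite -[RHS](@trunc_eval_cybe K A p (triple a b c) _ _ _ _ _ _ _ _ _ h1 h2).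
rewrite /Fab /Fac /Fbc !wpoly_mul !comm_wsum !trunc_eval_sum.
congr (_ + _ + _); rewrite -?sumrN; apply: eq_bigr => u _;
  rewrite trunc_eval_sum -?sumrN; apply: eq_bigr => v _.
- rewrite comm_Omega_aa // -(trunc_eval_mono T0) exprD.
  by congr (trunc_eval _ _ (_ * _)); ring.
- rewrite comm_Omega_bb // scalerN -(trunc_eval_mono T0) exprD.
  by congr (- trunc_eval _ _ (_ * _)); ring.
- rewrite comm_Omega_cc // -(trunc_eval_mono T0) exprD.
  by congr (trunc_eval _ _ (_ * _)); ring.
Qed.
End Weighted.
End Sites.

(** * Expansion coefficients of the r-matrix *)

Section Weights.
Variables (K : fieldType) (p : nat).
Local Notation U := ('I_p * 'I_p)%type.
Local Notation P := {poly {poly {poly K}}}.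

Definition fst_exp (u : U) : nat := u.1.
Definition snd_exp (u : U) : nat := u.2.
Definition inf_exp (u : U) : nat := (u.1 + u.2 + 1)%N.

(** Coefficients of [1 / (d + x - y)] here, and below of [1 / (c + x - 1 / w) = - w / (1 - w * (c +
    x))], whose extra factor [w] explains the [+ 1] in [inf_exp]. *)
Definition fin_weight (d : K) (u : U) : K :=
  'C(u.1 + u.2, u.2)%:R * (-1) ^+ u.1 * d ^- (1 + u.1 + u.2).
Definition inf_weight (c : K) (u : U) : K :=
  - ('C(u.1 + u.2, u.2)%:R * c ^+ u.2).

Lemma wpoly_fin (d : K) (x y : P) : d != 0 ->
  exists a b, (cst3 d + x - y) * wpoly (fin_weight d) fst_exp snd_exp x y
    = 1 + a * x ^+ p + b * y ^+ p.
Proof.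
move=> d0; have ds : cst3 d * cst3 d^-1 = 1 by rewrite -cst3M divff ?cst31.
have [a [b E]] := shifted_inverse p x y ds.
exists a, b; rewrite -E pair_bigA /wpoly; congr (_ * _); apply: eq_bigr => u _.
by rewrite /fin_weight -exprVn !cst3M !cst3X cst3N cst31 cst3_nat.
Qed.

Lemma wpoly_inf (c : K) (x w : P) :
  exists V b, wpoly (inf_weight c) fst_exp inf_exp x w = - (w * V) /\
    (1 - w * (cst3 c + x)) * V = 1 + b * w ^+ p.
Proof.
have [b E] := shifted_inverse_infty p (cst3 c) x w.
exists (\sum_u cst3 ('C((u : U).1 + u.2, u.2)%:R * c ^+ u.2) *
         (x ^+ u.1 * w ^+ (u.1 + u.2))), b; split.
  rewrite /wpoly mulr_sumr -sumrN; apply: eq_bigr => u _.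
  by rewrite /inf_weight /inf_exp /fst_exp cst3N exprD; ring.
rewrite -[RHS]E [in RHS]pair_bigA.
apply: (congr1 ( *%R _)).
apply: eq_bigr => u _.
by rewrite cst3M cst3X cst3_nat mulrA.
Qed.
End Weights.

(** * Skew-symmetry and the Yang-Baxter equation for the rational r-matrix *)

Section RMatrix.
Variables (K : fieldType) (g : vectType K) (br : g -> g -> g) (B : g -> g -> K).
Variables (X Xd : 'I_(\dim (fullv : {vspace g})) -> g).
Variables (p n : nat) (A : algType K) (rho : option 'I_n -> 'I_p -> g -> A).
Hypothesis brP : is_lie_bracket br.
Hypothesis BP : invariant_form br B.
Hypothesis BXXd : forall k l, B (X k) (Xd l) = (k == l)%:R.
Hypothesis rhoP : is_current_rep br rho.

(* [rmat t a b] stands for [Omega / (u_a - u_b)] with [u_i = t_i + z] and [u_oo = 1 / z]. *)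
Definition rmat (t : 'I_n -> K) (a b : option 'I_n) : A :=
  match a, b with
  | Some i, Some j =>
      wsum X Xd rho (fin_weight (t i - t j)) (@fst_exp p) (@snd_exp p) a b
  | Some i, None => wsum X Xd rho (inf_weight (t i)) (@fst_exp p) (@inf_exp p) a b
  | None, _ => 0
  end.

(** Swapping the sites swaps [m] and [l], and the sign [(-1) ^+ (1 + m + l)] from
    [t j - t i = - (t i - t j)] converts one alternating factor into the negative of the other. *)
Lemma rmatN t i j : i != j -> rmat t (Some j) (Some i) = - rmat t (Some i) (Some j).
Proof.
move=> ij; rewrite /rmat /wsum.
rewrite -(pair_bigA _ (fun m l => fin_weight (t j - t i) (m, l) *:
  Omega rho X Xd (Some j) (Some i) m l)).
rewrite -(pair_bigA _ (fun m l => fin_weight (t i - t j) (m, l) *: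
  Omega rho X Xd (Some i) (Some j) m l)).
rewrite exchange_big -sumrN; apply: eq_bigr => l _; rewrite -sumrN.
apply: eq_bigr => m _; rewrite (Omega_sym BP BXXd rhoP); last first.
  by apply: contra ij => /eqP[->].
rewrite -scaleNr; congr (_ *: _); rewrite /fin_weight /=.
rewrite -(opprB (t i)) -!exprVn invrN (exprNn (t i - t j)^-1) addnAC.
have -> : 'C(m + l, l) = 'C(l + m, m).
  by rewrite -bin_sub ?leq_addl // addnK addnC.
rewrite exprD exprS.
have sq : (-1) ^+ m * (-1) ^+ m = 1 :> K by rewrite -expr2 sqrr_sign.
rewrite -[RHS]mulr1 -[X in _ = _ * X]sq; ring.
Qed.

Lemma rmat_disjoint t i j k l : k != i -> k != j -> l != i -> l != j -> k != l ->
  i != j -> comm_br (rmat t i k) (rmat t j l) = 0.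
Proof.
move=> ki kj li lj kl ij; rewrite /rmat.
case: i ki li ij => [i|] ki li ij; last by rewrite comm_br0l.
case: j kj lj ij => [j|] kj lj ij; last by rewrite comm_br0r.
case: k ki kj kl => [k|] ki kj kl; case: l li lj kl => [l|] li lj kl.
- by apply: (comm_wsum_disjoint X Xd rhoP); rewrite // eq_sym.
- by apply: (comm_wsum_disjoint X Xd rhoP); rewrite // eq_sym.
- by apply: (comm_wsum_disjoint X Xd rhoP); rewrite // eq_sym.
by rewrite eqxx in kl.
Qed.

Lemma rmat_cybe t i j k : (forall i j, i != j -> t i != t j) -> i != j ->
  k != Some i -> k != Some j ->
  comm_br (rmat t (Some i) (Some j)) (rmat t (Some i) k)
  + comm_br (rmat t (Some i) (Some j)) (rmat t (Some j) k)
  + comm_br (rmat t (Some i) k) (rmat t (Some j) k) = 0.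
Proof.
move=> tconf ij.
have dne x y : x != y -> t x - t y != 0 by move=> /tconf; rewrite subr_eq0.
have ij' : Some i != Some j by apply: contra ij => /eqP[->].
have [a1 [b1 Eab]] := wpoly_fin p (va K) (vb K) (dne _ _ ij).
case: k => [k|] ki kj.
  have ik : i != k by apply: contra ki => /eqP->.
  have jk : j != k by apply: contra kj => /eqP->.
  have [a2 [c2 Eac]] := wpoly_fin p (va K) (vc K) (dne _ _ ik).
  have [a3 [c3 Ebc]] := wpoly_fin p (vb K) (vc K) (dne _ _ jk).
  rewrite /rmat; set Fac := wpoly _ _ _ _ _ in Eac; set Fbc := wpoly _ _ _ _ _ in Ebc.
  (* With [e = (u_a - u_c) - (u_b - u_c)], the error terms are [Fbc] times those of [Eac] minus
     [Fac] times those of [Ebc]. *)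
  apply: (wsum_cybe brP BP BXXd rhoP (e := cst3 (t i - t j) + va K - vb K)
    (a1 := a1) (b1 := b1) (a2 := a2 * Fbc) (b2 := - (a3 * Fac)) (c2 := c2 * Fbc - c3 * Fac)).
  - by [].
  - by rewrite eq_sym.
  - by rewrite eq_sym.
  - exact: Eab.
  rewrite -/Fac -/Fbc.
  rewrite (_ : cst3 (t i - t j) + _ - _ = (cst3 (t i - t k) + va K - vc K)
    - (cst3 (t j - t k) + vb K - vc K)); last by rewrite !cst3B; ring.
  rewrite mulrBl Eac mulrBl.
  rewrite (_ : (_ + vb K - vc K) * Fac * Fbc = ((cst3 (t j - t k) + vb K - vc K) * Fbc) * Fac).
    rewrite Ebc; ring.
  ring.
have [V [c2 [Eac EV]]] := wpoly_inf p (t i) (va K) (vc K).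
have [W [c3 [Ebc EW]]] := wpoly_inf p (t j) (vb K) (vc K).
rewrite /rmat.
(* Now [Fac = - (w * V)] and [Fbc = - (w * W)] with [w = vc K]. Both inversions hold modulo [w ^+ p]
   alone, so only [c2] is nonzero. *)
apply: (wsum_cybe brP BP BXXd rhoP (e := cst3 (t i - t j) + va K - vb K)
  (a1 := a1) (b1 := b1) (a2 := 0) (b2 := 0) (c2 := vc K * (V * c3 - W * c2))) => //.
rewrite Eac Ebc.
transitivity (- (cst3 (t i - t j) + va K - vb K) * (vc K * V) * (vc K * W) -
   vc K * (V * (1 - (1 - vc K * (cst3 (t j) + vb K)) * W)
           - W * (1 - (1 - vc K * (cst3 (t i) + va K)) * V))).
  rewrite cst3B; ring.
rewrite EV EW; ring.
Qed.

Lemma rmat_sum_comm t i j : (forall i j, i != j -> t i != t j) ->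
  comm_br (\sum_(k | k != Some i) rmat t (Some i) k)
          (\sum_(k | k != Some j) rmat t (Some j) k) = 0.
Proof.
move=> tconf; have [->|ij] := eqVneq i j; first by rewrite /comm_br subrr.
apply: gaudin_comm.
- by apply: contra ij => /eqP[->].
- exact: rmatN.
- by move=> k l *; apply: rmat_disjoint => //; apply: contra ij => /eqP[->].
- by move=> k *; apply: rmat_cybe.
Qed.
End RMatrix.

(** * Partial derivatives *)

Section Derivatives.
Variable K : numFieldType.

Lemma is_derive_affine (u e : K) : is_derive (0 : K) (1 : K) (fun h => u + e * h) e.
Proof.
have h1 := is_derive_cst (u : K) (0 : K) (1 : K).
have h2 := @is_deriveZ K K K id e (0 : K) (1 : K) 1 (is_derive_id _ _).
have := is_deriveD h1 h2.
by rewrite add0r [e *: 1]mulr1.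
Qed.

Lemma affine_neq0_near (u e : K) : u != 0 -> \forall h \near (0 : K), u + e * h != 0.
Proof.
move=> u0; have [dv _] := is_derive_affine u e.
move/derivable1_diffP/differentiable_continuous: dv => cv.
by apply: (cvgr_neq0 _ cv); rewrite mulr0 addr0.
Qed.

Lemma is_derive_affineX (u e : K) k :
  is_derive (0 : K) (1 : K) (fun h => (u + e * h) ^+ k) (k%:R * u ^+ k.-1 * e).
Proof.
have := @is_deriveX K K (fun h => u + e * h) k 0 1 e (is_derive_affine u e).
have -> : (fun h => u + e * h) ^+ k = (fun h => (u + e * h) ^+ k).
  by apply/funext => h; rewrite fctE.
by rewrite mulr0 addr0.
Qed.

Lemma is_derive_affineVX (u e : K) k : u != 0 ->
  is_derive (0 : K) (1 : K) (fun h => (u + e * h) ^- k) (- (k%:R * u ^- k.+1 * e)).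
Proof.
move=> u0; have h := is_derive_affineX u e k.
have nz : (u + e * 0) ^+ k != 0 by rewrite mulr0 addr0 expf_neq0.
case: h => dv dE; apply: DeriveDef; first exact: derivableV.
rewrite deriveV // dE mulr0 addr0 /GRing.scale /= mulNr; congr (- _).
(* The case [k = 0] is separate because of [k.-1]; there both sides carry the factor [0]. *)
case: k {dv dE nz} => [|k]; first by rewrite !mul0r mulr0.
rewrite /= !exprS; have : u ^+ k != 0 by rewrite expf_neq0.
set y := u ^+ k; set c := k.+1%:R => y0.
by field; rewrite u0 y0.
Qed.

Lemma is_derive_scal (c : K) (f : K -> K) (x v df : K) :
  is_derive x v f df -> is_derive x v (fun h => c * f h) (c * df).
Proof. by move=> h; apply: (@is_deriveZ K K K f c x v df h). Qed.

Lemma is_derive_near0 (f : K -> K) (x v df : K) :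
  (\forall h \near x, f h = 0) -> is_derive x v f df -> df = 0.
Proof.
move=> f0 fdf.
have : is_derive x v f 0.
  apply: near_eq_is_derive (is_derive_cst (0 : K) x v).
  by apply: filterS f0 => h ->.
by move=> h; rewrite -(@derive_val _ _ _ _ _ _ _ fdf) -(@derive_val _ _ _ _ _ _ _ h).
Qed.

(* Induction on the number of vectors: a linear relation eliminates one, and without any
   relation all coefficients vanish near x. *)
Lemma derive_lin_comb0 (A : lmodType K) (I : finType) (P : {set I})
    (f : I -> K -> K) (df : I -> K) (a : I -> A) (x v : K) :
  (forall k, is_derive x v (f k) (df k)) ->
  (\forall h \near x, \sum_(k in P) f k h *: a k = 0) ->
  \sum_(k in P) df k *: a k = 0.
Proof.
have [n le_n] := ubnP #|P|; elim: n => // n IH in P f df le_n *.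
move=> fdf f0.
have [[c [c0 [k0 [k0P ck0]]]]|free] := pselect (exists c : I -> K,
  \sum_(k in P) c k *: a k = 0 /\ exists k0, k0 \in P /\ c k0 != 0); last first.
  apply: big1 => k kP; rewrite (_ : df k = 0) ?scale0r //.
  apply: is_derive_near0 (fdf k).
  apply: filterS f0 => h h0; apply/eqP; apply: contrapT => /negP fk.
  by apply: free; exists (f^~ h); split=> //; exists k.
have ak0 : a k0 = - \sum_(k in P :\ k0) (c k / c k0) *: a k.
  have := c0; rewrite (big_setD1 k0) //= => /(congr1 (fun w => (c k0)^-1 *: w)).
  rewrite scaler0 scalerDr scalerA mulVf // scale1r => /eqP; rewrite addr_eq0.
  move=> /eqP->; rewrite scaler_sumr; congr (- _); apply: eq_bigr => k _.
  by rewrite scalerA mulrC.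
(* Stated for arbitrary coefficients, so that the same elimination of [a k0] applies to the
   functions and to their derivatives. *)
have red (w : I -> K) : \sum_(k in P) w k *: a k =
    \sum_(k in P :\ k0) (w k - (c k / c k0) * w k0) *: a k.
  rewrite (big_setD1 k0) //= {1}ak0 scalerN scaler_sumr -sumrN -big_split /=.
  apply: eq_bigr => k _; rewrite scalerA scalerBl addrC.
  by rewrite (mulrC (w k0)).
have red_der k : is_derive x v (fun h => f k h - (c k / c k0) * f k0 h)
    (df k - (c k / c k0) * df k0).
  exact: (is_deriveB (fdf k) (is_derive_scal _ (fdf k0))).
rewrite red; apply: IH red_der _; first by move: le_n; rewrite (cardsD1 k0 P) k0P.
by apply: filterS f0 => h; rewrite (red (f^~ h)).
Qed.
End Derivatives.

(** * Existence and uniqueness of partial derivatives on the configuration space *)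

Section Partial.
Variables (R : realType) (n : nat) (A : lmodType (CC R)).
Implicit Types (t : 'I_n -> CC R) (F D : ('I_n -> CC R) -> A).

Lemma updE t j h a : upd t j h a = t a + (a == j)%:R * h.
Proof. by rewrite /upd; case: eqP; rewrite ?mul1r ?mul0r. Qed.

(** Each difference [t a - t b] is affine in [h] and nonzero at [0]; there are finitely many
    pairs. *)
Lemma conf_upd_near t j : conf t -> \forall h \near (0 : CC R), conf (upd t j h).
Proof.
move=> ct.
have : \forall h \near (0 : CC R), forall ab : 'I_n * 'I_n, ab.1 != ab.2 ->
    upd t j h ab.1 != upd t j h ab.2.
  apply: (filter_forall (F := nbhs (0 : CC R))) => -[a b] /=.
  have [->|ab] := eqVneq a b; first by apply: nearW.
  have u0 : t a - t b != 0 by rewrite subr_eq0; apply: ct.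
  apply: filterS (affine_neq0_near ((a == j)%:R - (b == j)%:R) u0) => h hn _.
  rewrite !updE -subr_eq0; apply: contra hn => /eqP hn; apply/eqP; rewrite -hn; ring.
by apply: filterS => h H a b ab; exact: (H (a, b)).
Qed.

(** The two presentations of [F] may use different vectors. Their difference is one linear
    combination, indexed by the disjoint union, that vanishes near [h = 0]; hence [derive_lin_comb0]
    applies. *)
Lemma has_partial_uniq F j D1 D2 t :
  has_partial_on conf F j D1 -> has_partial_on conf F j D2 -> conf t -> D1 t = D2 t.
Proof.
move=> [N1 [f1 [df1 [a1 H1]]]] [N2 [f2 [df2 [a2 H2]]]] ct.
pose f (s : 'I_N1 + 'I_N2) (h : CC R) : CC R :=
  match s with inl k => f1 k (upd t j h) | inr k => - f2 k (upd t j h) end.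
pose df (s : 'I_N1 + 'I_N2) : CC R :=
  match s with inl k => df1 k t | inr k => - df2 k t end.
pose a (s : 'I_N1 + 'I_N2) : A := match s with inl k => a1 k | inr k => a2 k end.
have [_ -> d1] := H1 t ct; have [_ -> d2] := H2 t ct.
have E : \sum_(s in [set: 'I_N1 + 'I_N2]) df s *: a s = 0.
  apply: (@derive_lin_comb0 _ A _ _ f df a 0 1).
    by case=> k; [exact: d1|exact: (is_deriveN (d2 k))].
  have := conf_upd_near j ct; apply: filterS => h ch.
  under eq_bigl do rewrite finset.in_setT.
  rewrite big_sumType /=.
  have [<- _ _] := H1 _ ch; under eq_bigr do rewrite scaleNr.
  by rewrite sumrN; have [<- _ _] := H2 _ ch; rewrite subrr.
move: E; under eq_bigl do rewrite finset.in_setT.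
rewrite big_sumType /=; under [X in _ + X]eq_bigr do rewrite scaleNr.
by rewrite sumrN => /eqP; rewrite subr_eq0 => /eqP.
Qed.

Lemma has_partial_fin (I : finType) (f df : I -> ('I_n -> CC R) -> CC R) (a : I -> A) F j :
  (forall t, conf t -> F t = \sum_k f k t *: a k) ->
  (forall t k, conf t ->
     is_derive (0 : CC R) (1 : CC R) (fun h => f k (upd t j h)) (df k t)) ->
  has_partial_on conf F j (fun t => \sum_k df k t *: a k).
Proof.
move=> Ff fdf; exists #|I|, (fun k => f (enum_val k)), (fun k => df (enum_val k)),
  (fun k => a (enum_val k)) => t ct.
split; last by move=> k; apply: fdf.
  by rewrite Ff // (big_enum_val (fun k => f k t *: a k)).
by rewrite (big_enum_val (fun k => df k t *: a k)).
Qed.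
End Partial.

(** * Coefficients, derivatives and commutation of the Hamiltonians *)

Section Hamiltonian.
Variables (R : realType) (g : vectType (CC R)) (br : g -> g -> g) (B : g -> g -> CC R).
Variables (X Xd : 'I_(\dim (fullv : {vspace g})) -> g) (hv kappa : CC R).
Variables (p n : nat) (A : algType (CC R)) (rho : option 'I_n -> 'I_p -> g -> A).

Local Notation U := ('I_p * 'I_p)%type.
Local Notation H := (Hhat rho X Xd kappa hv).
Local Notation nu := (kappa + hv)^-1.

Lemma Hhat_rmat j t :
  H j t = - nu *: \sum_(b | b != Some j) rmat X Xd rho t (Some j) b.
Proof.
rewrite (bigD1 None) //= scalerDr addrC; congr (_ + _).
  rewrite /Hhat1 scaleNr; congr (- (_ *: _)).
  rewrite (reindex_omap Some id) /=; last by case.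
  apply: eq_big => [k|k _]; last by rewrite pair_bigA.
  by rewrite eqxx !andbT.
rewrite /Hhat2 /wsum scaleNr -scalerN -sumrN pair_bigA; congr (_ *: _).
by apply: eq_bigr => u _; rewrite /inf_weight scaleNr opprK.
Qed.

Definition ham_coef (t : 'I_n -> CC R) (j : 'I_n) (s : option 'I_n * U) : CC R :=
  match s.1 with
  | Some k => if k == j then 0 else - nu * fin_weight (t j - t k) s.2
  | None => - nu * inf_weight (t j) s.2
  end.

(** The derivative of [ham_coef] in [t i]; the differences of Kronecker symbols are the derivatives
    of [t j - t k]. At [l = 0] the value of [l.-1] is harmless, being multiplied by [l%:R]. *)
Definition ham_dcoef (i : 'I_n) (t : 'I_n -> CC R) (j : 'I_n)
    (s : option 'I_n * U) : CC R :=
  let: (m, l) := (nat_of_ord s.2.1, nat_of_ord s.2.2) in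
  match s.1 with
  | Some k => if k == j then 0 else - nu * ('C(m + l, l)%:R * (-1) ^+ m *
      - ((1 + m + l)%:R * (t j - t k) ^- (1 + m + l).+1 * ((j == i)%:R - (k == i)%:R)))
  | None => - nu * (- 'C(m + l, l)%:R * (l%:R * t j ^+ l.-1 * (j == i)%:R))
  end.

Definition ham_vec (j : 'I_n) (s : option 'I_n * U) : A :=
  Omega rho X Xd (Some j) s.1 s.2.1
    (match s.1 with Some _ => snd_exp s.2 | None => inf_exp s.2 end).

Lemma Hhat_coef j t : H j t = \sum_s ham_coef t j s *: ham_vec j s.
Proof.
rewrite Hhat_rmat big_mkcond scaler_sumr.
rewrite -(pair_bigA _ (fun b u => ham_coef t j (b, u) *: ham_vec j (b, u))) /=.
apply: eq_bigr => -[k|] _.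
  have -> : (Some k == Some j) = (k == j) by apply/eqP/eqP => [[]|->].
  rewrite /ham_coef /=; have [->|kj] := eqVneq k j.
    by rewrite scaler0 big1 // => u _; rewrite scale0r.
  by rewrite scaler_sumr; apply: eq_bigr => u _; rewrite scalerA.
by rewrite scaler_sumr; apply: eq_bigr => u _; rewrite scalerA.
Qed.

Lemma ham_coef_derive i j t s : conf t ->
  is_derive (0 : CC R) (1 : CC R) (fun h => ham_coef (upd t i h) j s) (ham_dcoef i t j s).
Proof.
move=> ct; case: s => [[k|] [m l]]; rewrite /ham_coef /ham_dcoef /=.
  have [_|kj] := eqVneq k j; first exact: is_derive_cst.
  have u0 : t j - t k != 0 by rewrite subr_eq0; apply: ct; rewrite eq_sym.
  have D := is_derive_affineVX ((j == i)%:R - (k == i)%:R) (1 + m + l) u0.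
  have := is_derive_scal (- nu) (is_derive_scal ('C(m + l, l)%:R * (-1) ^+ m) D).
  congr is_derive; apply/funext => h; rewrite /fin_weight /= !updE.
  by congr (_ * (_ * _^-1)); congr (_ ^+ _); ring.
have D := is_derive_affineX (t j) (j == i)%:R l.
have := is_derive_scal (- nu) (is_derive_scal (- 'C(m + l, l)%:R) D).
congr is_derive; apply/funext => h; rewrite /inf_weight /= !updE.
by congr (_ * _); rewrite mulNr.
Qed.

Lemma Hhat_partial i j :
  has_partial_on conf (H j) i (fun t => \sum_s ham_dcoef i t j s *: ham_vec j s).
Proof.
exact: (has_partial_fin (fun t _ => Hhat_coef j t) (fun t s => @ham_coef_derive i j t s)).
Qed.

Lemma ham_dcoef_sum i j t : i != j ->
  \sum_s ham_dcoef i t j s *: ham_vec j s =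
  \sum_(m < p) \sum_(l < p) (- nu * ('C(m + l, l)%:R * (-1) ^+ m * (1 + m + l)%:R *
      (t j - t i) ^- (1 + m + l).+1)) *: Omega rho X Xd (Some j) (Some i) m l.
Proof.
move=> ij; have ji : (j == i) = false by rewrite eq_sym (negbTE ij).
rewrite -(pair_bigA _ (fun b u => ham_dcoef i t j (b, u) *: ham_vec j (b, u))) /=.
rewrite (bigD1 (Some i)) //= [X in _ + X]big1 ?addr0; last first.
  move=> [k|] ki; apply: big1 => u _; rewrite /ham_dcoef /= ji; last first.
    by rewrite !mulr0 scale0r.
  have -> : (k == i) = false by apply/eqP => E; rewrite E eqxx in ki.
  by case: (k == j); rewrite ?subrr ?mulr0 ?oppr0 ?mulr0 scale0r.
rewrite [RHS]pair_bigA; apply: eq_bigr => u _; rewrite /ham_dcoef /= (negbTE ij) ji eqxx.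
rewrite [false%:R - _](_ : _ = -1) ?sub0r //; congr (_ *: _); ring.
Qed.

Hypothesis brP : is_lie_bracket br.
Hypothesis BP : invariant_form br B.
Hypothesis BXXd : forall k l, B (X k) (Xd l) = (k == l)%:R.
Hypothesis rhoP : is_current_rep br rho.

(** As in [rmatN], the sites and the indices [m], [l] are swapped together, but the power of
    [t j - t i] is one higher, so no overall sign remains. *)
Lemma ham_dcoef_sym i j t : i != j ->
  \sum_s ham_dcoef i t j s *: ham_vec j s = \sum_s ham_dcoef j t i s *: ham_vec i s.
Proof.
move=> ij; rewrite (ham_dcoef_sum _ ij) ham_dcoef_sum 1?eq_sym // exchange_big /=.
apply: eq_bigr => m _; apply: eq_bigr => l _.
rewrite (Omega_sym BP BXXd rhoP); last by apply: contra ij => /eqP[->].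
congr (_ *: _); congr (_ * _).
have -> : 'C(l + m, m) = 'C(m + l, l) by rewrite -bin_sub ?leq_addl // addnK addnC.
rewrite -(opprB (t i)) -!exprVn invrN (exprNn (t i - t j)^-1) addnAC.
have -> : (-1) ^+ (1 + m + l).+1 = (-1) ^+ m * (-1) ^+ l :> CC R.
  by rewrite add1n addSn !exprS exprD !mulN1r opprK.
have sq : (-1) ^+ l * (-1) ^+ l = 1 :> CC R by rewrite -expr2 sqrr_sign.
rewrite -[RHS]mulr1 -[X in _ = _ * X]sq; ring.
Qed.

Lemma Hhat_comm i j t : conf t -> H i t * H j t = H j t * H i t.
Proof.
move=> ct; apply/eqP; rewrite -subr_eq0; apply/eqP.
rewrite -/(comm_br _ _) !Hhat_rmat comm_brZ.
by rewrite (rmat_sum_comm brP BP BXXd rhoP) // scaler0.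
Qed.
End Hamiltonian.

(** Flatness is stated in components, with [D i j] the derivative of [H j] in [t i], and for every
    algebra [A] carrying a representation of the sum of [n + 1] copies of the truncated current
    algebra. *)
Theorem mainTheorem16 (R : realType) (g : vectType (CC R)) (br : g -> g -> g)
    (B : g -> g -> CC R) (hv kappa : CC R)
    (X Xd : 'I_(\dim (fullv : {vspace g})) -> g)
    (p n : nat) (A : algType (CC R)) (rho : option 'I_n -> 'I_p -> g -> A) :
  simple_lie br ->
  invariant_form br B ->
  (forall x y, killing br x y = 2%:R * hv * B x y) ->
  (forall k l, B (X k) (Xd l) = (k == l)%:R) ->
  kappa + hv != 0 ->
  (1 <= p)%N -> (1 <= n)%N ->
  is_current_rep br rho ->
  let H := Hhat rho X Xd kappa hv in
  (forall i j t, conf t -> H i t * H j t = H j t * H i t) /\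
  (forall i j, exists D, has_partial_on conf (H j) i D) /\
  (forall D : 'I_n -> 'I_n -> ('I_n -> CC R) -> A,
     (forall i j, has_partial_on conf (H j) i (D i j)) ->
     forall i j t, conf t -> D i j t - D j i t = H i t * H j t - H j t * H i t).
Proof.
move=> [brP _ _] BP _ BXXd _ _ _ rhoP H.
have comm := Hhat_comm hv kappa brP BP BXXd rhoP.
split; [|split].
- exact: comm.
- by move=> i j; eexists; exact: Hhat_partial.
(* The right side vanishes by commutation. What remains is closedness of the connection form,
   checked on the explicit derivatives after uniqueness replaces [D] by them. *)
move=> D HD i j t ct; rewrite {1}/H comm // subrr.
have [->|ij] := eqVneq i j; first by rewrite subrr.
rewrite (has_partial_uniq (HD i j) (Hhat_partial _ _ _ _ _ i j) ct).
rewrite (has_partial_uniq (HD j i) (Hhat_partial _ _ _ _ _ j i) ct).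
by rewrite (ham_dcoef_sym hv kappa BP BXXd rhoP) // subrr.
Qed.
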